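(* Let $n\ge 3$ and consider the system (S) of differential equations ($'=\frac{d}{dt}$) for functions $f_0,\dots,f_{n-1},d_0,\dots,d_{n-1}$ of $t$ with $\sum_j d_j=0$, $\prod_j f_j=t$: $$t\frac{f_0'}{f_0}=d_0-d_{n-1},\quad t\frac{f_j'}{f_j}=d_j-d_{j-1}\ (1\le j\le n-2),\quad t\frac{f_{n-1}'}{f_{n-1}}=d_{n-1}-d_{n-2}+1,$$ $$t\,d_j'=f_{j+1}-f_j\ (0\le j\le n-2),\quad t\,d_{n-1}'=f_0-f_{n-1}.$$ Then (S) is preserved by the transformation $$\rho:\ (f_0,\dots,f_{n-1})\mapsto(f_1,f_2,\dots,f_{n-1},f_0),\quad (d_0,\dots,d_{n-1})\mapsto\Big(d_1-\tfrac1n,\dots,d_{n-2}-\tfrac1n,\ d_{n-1}+\tfrac{n-1}{n},\ d_0-\tfrac1n\Big),$$ and there exist a permutation $\pi$ of $\{0,\dots,n-1\}$ with $\pi^2=1$ and constants $c_j\in\{\tfrac1n,-\tfrac{n-1}{n}\}$ with $\sum_j c_j=0$ such that (S) is also preserved by $$\sigma:\ (f_0,\dots,f_{n-1})\mapsto(f_{n-1},f_{n-2},\dots,f_1,f_0),\quad d_j\mapsto -d_{\pi(j)}+c_j\ (0\le j\le n-1).$$ The transformations $\rho$ and $\sigma$ generate a dihedral group of order $2n$. Moreover $f_0=\dots=f_{n-1}=t^{1/n}$, together with corresponding $d_j$'s, is an (algebraic) solution of (S).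
   Context: ''Preserved'' means that the transformation sends every solution of (S) (including the constraints $\sum d_j=0$, $\prod f_j=t$) to a solution of (S). In the formula for $\rho$, the $j$-th entry of the right-hand tuple is the new value of $d_j$ (so the new $d_j$ is $d_{j+1}-\frac1n$ for $0\le j\le n-3$, the new $d_{n-2}$ is $d_{n-1}+\frac{n-1}{n}$, and the new $d_{n-1}$ is $d_0-\frac1n$). *)

(* Defs.v *)
From HB Require Import structures.
From mathcomp Require Import all_boot all_order all_algebra all_fingroup all_solvable.
From mathcomp Require Import complex.
From mathcomp Require Import all_classical all_reals all_analysis.

Set Implicit Arguments.
Unset Strict Implicit.
Unset Printing Implicit Defensive.

Import Order.TTheory GRing.Theory Num.Theory numFieldNormedType.Exports.
Local Open Scope classical_set_scope.
Local Open Scope ring_scope.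

(** Values [(f, d)] of the unknowns [f_0, .., f_(n-1)], [d_0, .., d_(n-1)]. *)
Definition state (K : numFieldType) (n : nat) : Type :=
  ('rV[K]_n * 'rV[K]_n)%type.

(** The unknowns are functions on an open set avoiding [0]: since
    [\prod_j f_j = t], at [t = 0] some logarithmic derivative [f_j' / f_j] is
    undefined, while for [t != 0] no [f_j] vanishes. *)
Definition admissible (K : numFieldType) (U : set K) : Prop :=
  open U /\ ~ U 0.

(** The system (S) on [U]. Indices are cyclic ([ord_pred] sends [0] to [n-1],
    [ordS] sends [n-1] to [0]); the boolean coerced to [K] is the extra [+ 1]
    in the equation for [f_(n-1)]. Derivatives are taken in the field [K], so
    they are complex derivatives when [K] is [R[i]]. *)
Definition solves (K : numFieldType) (n : nat) (U : set K)
    (x : K -> state K n) : Prop :=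
  let f (j : 'I_n) (t : K) : K := (x t).1 0 j in
  let d (j : 'I_n) (t : K) : K := (x t).2 0 j in
  forall t : K, U t ->
  [/\ forall j, derivable (f j) t 1 /\ derivable (d j) t 1,
      \sum_j d j t = 0,
      \prod_j f j t = t,
      forall j, t * (derive1 (f j) t / f j t)
                = d j t - d (ord_pred j) t + ((j : nat) == n.-1)%:R
    & forall j, t * derive1 (d j) t = f (ordS j) t - f j t].

Definition preserves_S (K : numFieldType) (n : nat)
    (T : state K n -> state K n) : Prop :=
  forall (U : set K) (x : K -> state K n),
    admissible U -> solves U x -> solves U (T \o x).

Definition rho (K : numFieldType) (n : nat) (x : state K n) : state K n :=
  (\row_j x.1 0 (ordS j),
   \row_j (x.2 0 (ordS j)
           + (if (j : nat) == (n - 2)%N then (n%:R - 1) / n%:R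
              else - (1 / n%:R)))).

Definition sigma (K : numFieldType) (n : nat) (pi : {perm 'I_n})
    (c : 'I_n -> K) (x : state K n) : state K n :=
  (\row_j x.1 0 (rev_ord j), \row_j (- x.2 0 (pi j) + c j)).

Definition transformation_group (T : Type) (G : set (T -> T)) : Prop :=
  [/\ G id,
      forall g h, G g -> G h -> G (g \o h)
    & forall g, G g -> exists h, [/\ G h, cancel g h & cancel h g]].

Definition generated_by (T : Type) (A : set (T -> T)) : set (T -> T) :=
  smallest (@transformation_group T) A.

(** [G] is, under composition, isomorphic to the dihedral group ['D_m], which
    has order [m] for even [m >= 4]. *)
Definition dihedral_of_order (m : nat) (T : Type) (G : set (T -> T)) : Prop :=
  exists phi : dihedral_gtype m -> T -> T,
    [/\ injective phi,
        forall a b, phi (a * b)%g = phi a \o phi b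
      & range phi = G].

(** [r] is a branch of [t^(1/n)] on [U]. *)
Definition root_branch (K : numFieldType) (n : nat) (U : set K) (r : K -> K) :
    Prop :=
  forall t, U t -> {for t, continuous r} /\ r t ^+ n = t.

(** In [R[i]], [z <= 0] means that [z] is real and nonpositive, so this is the
    plane slit along the closed negative real axis. *)
Definition slit_plane (K : numFieldType) : set K := [set z | ~ (z <= 0)].

(** [g] satisfies [P(t, g(t)) = 0] on [U], where [P != 0] is a polynomial in
    [y] (the outer variable) with coefficients in [K[t]]. *)
Definition algebraic_on (K : numFieldType) (U : set K) (g : K -> K) : Prop :=
  exists2 P : {poly {poly K}},
    P != 0 & forall t, U t -> P.[(g t)%:P].[t] = 0.

(* Main.v *)
Require Import Defs.
From HB Require Import structures.
From mathcomp Require Import all_boot all_order all_algebra all_fingroup all_solvable.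
From mathcomp Require Import complex.
From mathcomp Require Import all_classical all_reals all_analysis.
From mathcomp Require Import ring lra zify.
Import Order.TTheory GRing.Theory Num.Theory numFieldNormedType.Exports.
Local Open Scope classical_set_scope.
Local Open Scope ring_scope.

(** The constant values [q_j] of the [d_j] in the algebraic solution
    [f_0 = .. = f_(n-1) = t^(1/n)] satisfy
    [q_j - q_(j-1) + [j = n-1] = 1/n], so in the unknowns [u_j = d_j - q_j] the
    system becomes cyclically symmetric:
    [t f_j' / f_j = u_j - u_(j-1) + 1/n] and [t u_j' = f_(j+1) - f_j].
    In these unknowns [rho] is the shift [u_j |-> u_(j+1)] and [sigma] is
    [u_j |-> - u_(n-2-j)] (indices mod [n]), which makes the invariance and the
    dihedral relations evident; on the [f_j] alone the words
    [rho^i sigma^a] are already pairwise distinct when [n >= 3]. A continuous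
    branch [r] of [t^(1/n)] is differentiable because
    [r(t+h)^n - r(t)^n = h] factors through [r(t+h) - r(t)]. *)

(** * The system in cyclically symmetric form *)

Lemma val_ordS (n : nat) (j : 'I_n) :
  ordS j = (if (j : nat) == n.-1 then 0 else j.+1) :> nat.
Proof.
have hj := ltn_ord j; rewrite /=; case: eqP => hjn.
  by rewrite (_ : j.+1 = n) ?modnn //; lia.
by rewrite modn_small //; lia.
Qed.

Lemma val_ord_pred (n : nat) (j : 'I_n) :
  ord_pred j = (if (j : nat) == 0 then n.-1 else j.-1) :> nat.
Proof.
have hj := ltn_ord j; rewrite /=; case: eqP => [->|hj0].
  by rewrite add0n modn_small //; lia.
by rewrite (_ : (j + n).-1 = j.-1 + n)%N ?modnDr ?modn_small //; lia.
Qed.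

Lemma rev_ordS (n : nat) (j : 'I_n) : rev_ord (ordS j) = ord_pred (rev_ord j).
Proof.
apply: val_inj; rewrite [RHS]val_ord_pred.
rewrite -[LHS]/(n - (ordS j).+1)%N val_ordS -[rev_ord j : nat]/(n - j.+1)%N.
have := ltn_ord j; case: eqP => [->|]; case: eqP; lia.
Qed.

Lemma val_iter_ordS (n i : nat) (j : 'I_n) :
  iter i (@ordS n) j = ((j + i) %% n)%N :> nat.
Proof.
elim: i => [|i IH]; first by rewrite addn0 modn_small.
by rewrite iterS [LHS]/= IH -addn1 modnDml addn1 addnS.
Qed.

Section CyclicSystem.
Variables (K : numFieldType) (n : nat).
Hypothesis n_gt0 : (0 < n)%N.

Let n_neq0 : (n%:R : K) != 0.
Proof. by rewrite pnatr_eq0 -lt0n. Qed.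

(* The constants [q_j]. *)
Definition centre (j : 'I_n) : K :=
  (2 * (ordS j : nat)%:R + 1 - n%:R) / (2 * n%:R).

(** [centre] is affine in [ordS j] with slope [1 / n]. The only drop is where [ordS] wraps from
    [n - 1] to [0], which happens exactly at [j = n - 1] and accounts for the extra [1]. *)
Lemma centre_diff (j : 'I_n) :
  centre j - centre (ord_pred j) = 1 / n%:R - ((j : nat) == n.-1)%:R.
Proof.
rewrite /centre ord_predK val_ordS; case: eqP => [->|_] /=.
  by rewrite -subn1 natrB //; field.
by rewrite -natr1; field.
Qed.

(** Identifies the constants in [rho] as differences of centres, so that [rho] is a pure shift of
    the centred unknowns. The exceptional index is [n - 2] because [centre_diff] is applied at
    [ordS j]. *)
Lemma centre_rho (j : 'I_n) : (1 < n)%N ->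
  centre j - centre (ordS j) =
  if (j : nat) == (n - 2)%N then (n%:R - 1) / n%:R else - (1 / n%:R).
Proof.
move=> n_gt1; have := centre_diff (ordS j); rewrite ordSK => hd.
rewrite -opprB hd val_ordS; have hj := ltn_ord j.
case: (altP ((j : nat) =P n.-1)) => [->|hjn].
  have -> : (n.-1 == n - 2)%N = false by apply/eqP; lia.
  by have -> : (0 == n.-1)%N = false; [apply/eqP; lia | rewrite subr0].
have -> : (j.+1 == n.-1) = ((j : nat) == (n - 2)%N) by apply/eqP/eqP; lia.
by case: eqP => _ /=; field.
Qed.

Lemma sum_centre : \sum_j centre j = 0.
Proof.
(* The numerators [2k + 1 - n] are symmetric about [0]; the sum reduces to
   [2 * 'C(n, 2) + n = n * n]. *)
have sum2 : \sum_(j < n) (2 * (j : nat)%:R + 1 - n%:R) = 0 :> K.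
  rewrite big_split /= big_split /= !sumr_const card_ord -mulr_sumr -natr_sum.
  have -> : (\sum_(i < n) i)%N = 'C(n, 2) by rewrite -bin2_sum big_mkord.
  have h : (2 * 'C(n, 2) + n = n * n)%N.
    rewrite -mul_bin_diag bin1; case: (n) n_gt0 => // m _; lia.
  have := congr1 (fun m => m%:R : K) h; rewrite natrD !natrM => h'.
  rewrite mulNrn -[n%:R *+ n]mulr_natr; apply/eqP; rewrite subr_eq0; apply/eqP.
  by rewrite -h'.
rewrite /centre -mulr_suml (reindex_inj (@ord_pred_inj n)) /=.
under eq_bigr do rewrite -[X in 2 * X%:R]/(ordS (ord_pred _) : nat) ord_predK.
by rewrite sum2 mul0r.
Qed.

(** Common criterion for [rho] ([e = 1]) and [sigma] ([e = -1]): [p] permutes the [f_j], while [q]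
    with the factor [e] acts on the centred unknowns. The first compatibility condition carries the
    equations for [f_j'], the second those for [d_j']. *)
Lemma preserves_S_symmetry (e : K) (p q : 'I_n -> 'I_n) (T : state K n -> state K n) :
  injective p -> injective q ->
  (forall (u : 'I_n -> K) j,
     e * (u (q j) - u (q (ord_pred j))) = u (p j) - u (ord_pred (p j))) ->
  (forall (f : 'I_n -> K) j,
     e * (f (ordS (q j)) - f (q j)) = f (p (ordS j)) - f (p j)) ->
  (forall x j, (T x).1 0 j = x.1 0 (p j)) ->
  (forall x j, (T x).2 0 j = e * (x.2 0 (q j) - centre (q j)) + centre j) ->
  preserves_S T.
Proof.
move=> pI qI hu hf T1 T2 U x _ solx f' d' t Ut.
have /= [der sumd prodf eqf eqd] := solx t Ut; rewrite {}/f' {}/d'.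
have T1f j : (fun t => ((T \o x) t).1 0 j) = (fun t => (x t).1 0 (p j)).
  by apply: funext => s; rewrite /= T1.
(* Each new [d_j] is an old one scaled by [e] plus a constant, which the derivative does not see. *)
have T2d j : (fun t => ((T \o x) t).2 0 j) =
    e \*: (fun t => (x t).2 0 (q j)) + cst (centre j - e * centre (q j)).
  by apply: funext => s; rewrite /= T2 !fctE /= /GRing.scale /=; ring.
split=> [j||| j |j].
- rewrite T1f T2d; split; first exact: (der _).1.
  by apply: derivableD; [apply: derivableZ; exact: (der _).2 | exact: derivable_cst].
- under eq_bigr do rewrite /= T2.
  rewrite big_split /= sum_centre addr0 -mulr_sumr sumrB.
  have -> : \sum_j (x t).2 0 (q j) = 0 by rewrite -[RHS]sumd [RHS](reindex_inj qI).
  have -> : \sum_j centre (q j) = 0 by rewrite -[RHS]sum_centre [RHS](reindex_inj qI).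
  by rewrite subrr mulr0.
- by under eq_bigr do rewrite /= T1; rewrite -[RHS]prodf [RHS](reindex_inj pI).
(* Trading the indicator for a difference of centres gives [symf], the same equation at every index,
   which can then be read at [p j]. *)
- have step (i : 'I_n) : ((i : nat) == n.-1)%:R =
      1 / n%:R - (centre i - centre (ord_pred i)).
    by rewrite centre_diff; ring.
  have symf i : t * (derive1 (fun t => (x t).1 0 i) t / (x t).1 0 i) =
      ((x t).2 0 i - centre i) - ((x t).2 0 (ord_pred i) - centre (ord_pred i))
      + 1 / n%:R.
    by rewrite eqf step; ring.
  rewrite T1f [((T \o x) t).1 0 j]/= T1 symf /= !T2.
  have /= <- := hu (fun i => (x t).2 0 i - centre i) j.
  by rewrite step; ring.
- rewrite T2d derive1E deriveD; first last.
  + exact: derivable_cst.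
  + by apply: derivableZ; exact: (der _).2.
  rewrite derive_cst addr0 deriveZ; last exact: (der _).2.
  by rewrite /= !T1 -(hf (fun i => (x t).1 0 i)) -eqd derive1E /GRing.scale /=; ring.
Qed.

(** The map [j |-> n - 2 - j] modulo [n]; it fixes [n - 1]. *)
Definition reflection_perm : {perm 'I_n} :=
  perm (inj_comp (@ord_pred_inj n) (@rev_ord_inj n)).

Lemma reflection_permE j : reflection_perm j = ord_pred (rev_ord j).
Proof. by rewrite permE. Qed.

Lemma reflection_permK : involutive reflection_perm.
Proof. by move=> j; rewrite !reflection_permE -rev_ordS ord_predK rev_ordK. Qed.

(** Chosen so that [sigma] becomes a signed permutation, without constant, of the centred
    unknowns. *)
Definition reflection_shift (j : 'I_n) : K := centre j + centre (reflection_perm j).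

(** For [j < n - 1] the values of [ordS] at [j] and at its reflection add up to [n]; at the fixed
    point [n - 1] both are [0]. *)
Lemma reflection_shiftE j :
  reflection_shift j = 1 / n%:R - ((j : nat) == n.-1)%:R.
Proof.
rewrite /reflection_shift reflection_permE /centre ord_predK val_ordS.
have hj := ltn_ord j; rewrite -[rev_ord j : nat]/(n - j.+1)%N.
case: eqP => [->|_] /=; last by rewrite natrB //; field.
by rewrite prednK // subnn; field.
Qed.

Lemma sum_reflection_shift : \sum_j reflection_shift j = 0.
Proof. by rewrite big_split /= sum_centre add0r -[RHS]sum_centre [RHS](reindex_perm reflection_perm). Qed.

(** * Invariance of the system under [rho] and [sigma] *)

Lemma rho1E (x : state K n) j : (rho x).1 0 j = x.1 0 (ordS j).
Proof. by rewrite mxE. Qed.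

Lemma rho2E (x : state K n) j : (1 < n)%N ->
  (rho x).2 0 j = x.2 0 (ordS j) - centre (ordS j) + centre j.
Proof. by move=> n1; rewrite mxE -centre_rho //; ring. Qed.

Local Notation sigma := (@sigma K n reflection_perm reflection_shift).

Lemma sigma1E x j : (sigma x).1 0 j = x.1 0 (rev_ord j).
Proof. by rewrite mxE. Qed.

Lemma sigma2E x j : (sigma x).2 0 j =
  - (x.2 0 (reflection_perm j) - centre (reflection_perm j)) + centre j.
Proof. by rewrite mxE /reflection_shift; ring. Qed.

Lemma preserves_S_rho : (1 < n)%N -> preserves_S (@rho K n).
Proof.
move=> n1; apply: (@preserves_S_symmetry 1 (@ordS n) (@ordS n)) => [||u j|f j|x j|x j].
- exact: ordS_inj.
- exact: ordS_inj.
- by rewrite mul1r ordSK ord_predK.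
- by rewrite mul1r.
- exact: rho1E.
- by rewrite mul1r rho2E.
Qed.

Lemma preserves_S_sigma : preserves_S sigma.
Proof.
apply: (@preserves_S_symmetry (-1) (@rev_ord n) reflection_perm)
  => [||u j|f j|x j|x j].
- exact: rev_ord_inj.
- exact: perm_inj.
(* The reflection swaps the two terms of the difference, and the sign [-1] swaps them back. *)
- have -> : reflection_perm (ord_pred j) = rev_ord j.
    by rewrite reflection_permE -rev_ordS ord_predK.
  by rewrite reflection_permE; ring.
- by rewrite !reflection_permE ord_predK rev_ordS; ring.
- exact: sigma1E.
- by rewrite mulN1r sigma2E.
Qed.

(** * Dihedral relations and faithfulness *)

Lemma stateP (x y : state K n) :
  (forall j, x.1 0 j = y.1 0 j) -> (forall j, x.2 0 j = y.2 0 j) -> x = y.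
Proof.
by case: x y => [f d] [f' d'] /= hf hd; congr (_, _); apply/rowP => j.
Qed.

Lemma iter_rho1 i (x : state K n) j :
  (iter i (@rho K n) x).1 0 j = x.1 0 (iter i (@ordS n) j).
Proof. by elim: i j => [//|i IH] j; rewrite iterS rho1E IH -iterSr. Qed.

Lemma iter_rho2 i (x : state K n) j : (1 < n)%N ->
  (iter i (@rho K n) x).2 0 j =
  x.2 0 (iter i (@ordS n) j) - centre (iter i (@ordS n) j) + centre j.
Proof.
move=> n1; elim: i j => [|i IH] j; first by rewrite subrK.
by rewrite iterS rho2E // IH -iterSr addrK.
Qed.

Lemma iter_rho_n : (1 < n)%N -> iter n (@rho K n) =1 id.
Proof.
move=> n1 x; have ordSn j : iter n (@ordS n) j = j.
  by apply: val_inj; rewrite [LHS]val_iter_ordS modnDr modn_small.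
by apply: stateP => j; rewrite ?iter_rho1 ?iter_rho2 // ordSn // subrK.
Qed.

Lemma sigmaK : involutive sigma.
Proof.
move=> x; apply: stateP => j; first by rewrite !sigma1E rev_ordK.
by rewrite !sigma2E reflection_permK; ring.
Qed.

Lemma sigma_rhoK : (1 < n)%N -> involutive (sigma \o @rho K n).
Proof.
move=> n1 x; rewrite -[LHS]/(sigma (rho (sigma (rho x)))).
apply: stateP => j.
  by rewrite !(sigma1E, rho1E) rev_ordS ord_predK rev_ordK.
rewrite !(sigma2E, rho2E) // !reflection_permE.
by rewrite !(ord_predK, rev_ordK); ring.
Qed.

(** Tested on a state whose [f] part is the unit vector at index [0]: it is fixed only if shifting
    [0] by [i] returns to [0]. *)
Lemma iter_rho_id i : (iter i (@rho K n) =1 id) -> (n %| i)%N.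
Proof.
move=> h; pose j0 := Ordinal n_gt0.
have := h (delta_mx 0 j0, 0) => /(congr1 (fun x : state K n => x.1 0 j0)).
rewrite iter_rho1 /= !mxE !eqxx /=; case: (_ =P j0) => [hi _|_ /eqP]; last first.
  by rewrite eq_sym oner_eq0.
by move: hi => /(congr1 val); rewrite [LHS]val_iter_ordS add0n => /eqP.
Qed.

(** Unit vectors show that the shift by [i] would be the reversal of indices. Index [0] gives
    [i = n - 1] modulo [n], so index [1] goes to [0], whereas the reversal sends it to [n - 2],
    nonzero for [n > 2]. *)
Lemma iter_rho_sigma i : (2 < n)%N -> ~ (iter i (@rho K n) =1 sigma).
Proof.
move=> n2 h; have h1 j : iter i (@ordS n) j = rev_ord j.
  have := h (delta_mx 0 (rev_ord j), 0) => /(congr1 (fun x : state K n => x.1 0 j)).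
  rewrite iter_rho1 sigma1E /= !mxE !eqxx /=; case: (_ =P rev_ord j) => [//|_ /eqP].
  by rewrite eq_sym oner_eq0.
have n1 : (1 < n)%N by lia.
have /(congr1 val)/= := h1 (Ordinal n_gt0); rewrite val_iter_ordS /= add0n => e0.
have /(congr1 val)/= := h1 (Ordinal n1); rewrite val_iter_ordS /= -modnDmr e0.
by rewrite (_ : (1 + (n - 1) = n)%N) ?modnn; lia.
Qed.
End CyclicSystem.

(** * Dihedral groups of transformations *)

Section DihedralNormalForm.
Variables (T : Type) (n : nat) (rho sigma : T -> T).
Hypotheses (n_gt1 : (1 < n)%N).
Hypotheses (rho_n : iter n rho =1 id) (sigmaK : involutive sigma).
Hypothesis (sigma_rhoK : involutive (sigma \o rho)).
Hypothesis (rho_faithful : forall i, iter i rho =1 id -> (n %| i)%N).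
Hypothesis (rho_sigma : forall i, ~ iter i rho =1 sigma).

Let word (i a : nat) : T -> T := iter i rho \o iter a sigma.

Let iter_rho_mod i : iter (i %% n) rho =1 iter i rho.
Proof.
move=> x; rewrite [in RHS](divn_eq i n) addnC iterD; congr (iter _ _ _).
by elim: (i %/ n)%N => [//|k IH]; rewrite mulSn iterD rho_n.
Qed.

Let iter_sigma_mod a : iter (a %% 2) sigma =1 iter a sigma.
Proof.
move=> x; rewrite [in RHS](divn_eq a 2) addnC iterD; congr (iter _ _ _).
by elim: (a %/ 2)%N => [//|k IH]; rewrite mulSn iterD /= sigmaK.
Qed.

Let word_mod i a : word (i %% n) (a %% 2) = word i a.
Proof. by apply: funext => x; rewrite /word /= iter_rho_mod iter_sigma_mod. Qed.

(** The exponent [n - 1] stands for the inverse of [rho]; the relation comes from [sigma \o rho]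
    being an involution. *)
Let sigma_rho x : sigma (rho x) = iter n.-1 rho (sigma x).
Proof.
have h : rho (sigma (rho x)) = sigma x by rewrite -[LHS]sigmaK; congr sigma; exact: sigma_rhoK.
by rewrite -h -iterSr prednK ?rho_n // ltnW.
Qed.

Let sigma_iter_rho j x : sigma (iter j rho x) = iter (n.-1 * j) rho (sigma x).
Proof.
elim: j => [|j IH]; first by rewrite muln0.
by rewrite iterS sigma_rho IH mulnS iterD.
Qed.

Let word_mul i a j b : (a < 2)%N ->
  word i a \o word j b = word (i + (if a == 0 then j else n.-1 * j)) (a + b).
Proof.
case: a => [|[|//]] _; apply: funext => x; rewrite /word /= iterD //.
by rewrite sigma_iter_rho.
Qed.

Let iter_inj i : injective (iter i rho).
Proof.
apply: (@can_inj _ _ _ (iter (n - i %% n) rho)) => x.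
rewrite -[iter i rho x]iter_rho_mod -iterD subnK ?rho_n //.
by rewrite ltnW // ltn_mod ltnW.
Qed.

Let rho_eq i j : (i < n)%N -> (j <= i)%N -> iter i rho =1 iter j rho -> i = j.
Proof.
move=> lt_in le_ji eq_ij; have : (n %| i - j)%N.
  apply: rho_faithful => x; apply: (@iter_inj j).
  by rewrite -iterD subnKC.
by move=> /dvdnP[[|k]]; rewrite ?mul0n ?mulSn; lia.
Qed.

Let word_inj i a j b : (i < n)%N -> (a < 2)%N -> (j < n)%N -> (b < 2)%N ->
  word i a = word j b -> i = j /\ a = b.
Proof.
wlog le_ba : i a j b / (b <= a)%N.
  move=> h ? ? ? ? ?; have [le_ba|/ltnW le_ab] := leqP b a; first exact: h.
  by have [] := h j b i a.
move=> lt_in a2 lt_jn b2 eqw; have eqwx x : word i a x = word j b x by rewrite eqw.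
have eq_ab : a = b.
  case: a b le_ba a2 b2 eqw eqwx => [|[|//]] [|[|//]] // _ _ _ _ eqwx.
  (* An equality [rho^i sigma = rho^j] would make [sigma] the rotation [rho^(n - i + j)]. *)
  case: (rho_sigma (n - i + j)) => x; apply: (@iter_inj i).
  by rewrite -iterD addnA subnKC ?iterD ?rho_n 1?ltnW //; exact/esym/(eqwx x).
(* Evaluating both words at [sigma^a x] cancels [sigma], since [sigma^(2a)] is the identity. *)
subst b; split=> //; have eq_ij x : iter i rho x = iter j rho x.
  have := eqwx (iter a sigma x); rewrite /word /= -!iterD addnn.
  by rewrite -[iter a.*2 sigma x]iter_sigma_mod -muln2 modnMl.
have [le_ji|/ltnW le_ij] := leqP j i; first exact: rho_eq.
by apply/esym/rho_eq.
Qed.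

(** Both sides have unique normal forms, [x^i y^a] in the abstract group and [rho^i sigma^a] among
    transformations, with the same multiplication rule; [phi] matches them. *)
Lemma dihedral_generated :
  dihedral_of_order (2 * n) (generated_by [set rho; sigma]).
Proof.
pose D := dihedral_gtype (2 * n).
have isoD : [set: D]%SET \isog [set: dihedral_gtype n.*2]%SET.
  by rewrite /D mul2n isog_refl.
(* The presentation, applied to the group itself, supplies generators [x], [y] with [x^n = 1],
   [y^2 = 1] and [x^y = x^-1]. *)
have [cardD] := isoGrpP _ (Grp_dihedral n_gt1) isoD.
rewrite card_dihedral // in cardD *; move=> /existsP[[x y] /= /eqP[defD xn y2 xy]].
have {}defD : (<[x]> * <[y]>)%g = [set: D]%SET.
  by rewrite -norm_joinEr // norms_cycle xy groupV cycle_id.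
pose w (p : 'I_n * 'I_2) : D := (x ^+ p.1 * y ^+ p.2)%g.
have n_gt0 : (0 < n)%N by exact: ltnW.
pose rep i a : 'I_n * 'I_2 :=
  (Ordinal (ltn_pmod i n_gt0), Ordinal (ltn_pmod a (isT : (0 < 2)%N))).
have w_rep i a : w (rep i a) = (x ^+ i * y ^+ a)%g by rewrite /w /= !expg_mod.
have w_surj g : exists p, w p = g.
  have : g \in (<[x]> * <[y]>)%g by rewrite defD inE.
  by case/mulsgP => _ _ /cycleP[i ->] /cycleP[a ->] ->; exists (rep i a).
pose r g := projT1 (cid (w_surj g)).
have rK : cancel r w by move=> g; exact: projT2 (cid (w_surj g)).
(* [w] maps a set of [2 * n] elements onto a group of that order. *)
have wK : cancel w r.
  suff r_bij : bijective r by exact/(bij_can_sym r_bij).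
  apply: inj_card_bij (can_inj rK) _.
  by rewrite card_prod !card_ord muln2 -cardD cardsT.
pose phi g := word (r g).1 (r g).2.
have phi_word i a : phi (x ^+ i * y ^+ a)%g = word i a.
  by rewrite /phi -w_rep wK /= word_mod.
(* Commutation rule with the exponent [n - 1] in place of an inverse, to agree with [word_mul]. *)
have yx j : (y * x ^+ j)%g = (x ^+ (n.-1 * j) * y)%g.
  have xVn : ((x^-1) ^+ n.-1 = x)%g.
    by apply/eqP; rewrite expgVn eq_invg_mul -expgSr prednK // xn.
  by rewrite [RHS]conjgC conjXg xy expgM xVn.
have phiM g h : phi (g * h)%g = phi g \o phi h.
  rewrite -(rK g) -(rK h); case: (r g) (r h) => [i a] [j b].
  rewrite {1}/w /= !phi_word word_mul // -phi_word; congr phi.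
  rewrite /w /= !expgD -!mulgA; congr (_ * _)%g; rewrite !mulgA; congr (_ * _)%g.
  by case: a => [[|[|//]] ?] /=; rewrite ?expg0 ?mul1g ?mulg1 ?expg1.
have phi1 : phi 1%g = id by rewrite -(mulg1 1%g); exact: (phi_word 0 0).
exists phi; split=> //.
  move=> g h; rewrite /phi => /word_inj; rewrite !ltn_ord => -[//|//|//|//|].
  move=> /val_inj e1 /val_inj e2; apply: (can_inj rK).
  by rewrite [LHS]surjective_pairing e1 e2 -surjective_pairing.
(* Words lie in every transformation group containing [rho] and [sigma]; conversely the range of
   [phi] is itself such a group. *)
apply/seteqP; split=> [_ [g _ <-] G [[Gid Gcomp _] subG]|].
  have Giter i f : G f -> G (iter i f).
    by move=> Gf; elim: i => [//|i IH]; exact: (Gcomp f (iter i f)).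
  by apply: Gcomp; apply: Giter; apply: subG; [left|right].
apply: smallest_sub.
  split=> [|_ _ [g _ <-] [h _ <-]|_ [g _ <-]].
  - by exists 1%g.
  - by exists (g * h)%g; rewrite ?phiM.
  - exists (phi g^-1)%g; split; first by exists g^-1%g.
    + by move=> z; rewrite -[LHS]/((phi _ \o phi _) z) -phiM mulVg phi1.
    + by move=> z; rewrite -[LHS]/((phi _ \o phi _) z) -phiM mulgV phi1.
move=> _ [->|->].
- by exists (x ^+ 1 * y ^+ 0)%g; rewrite ?phi_word.
- by exists (x ^+ 0 * y ^+ 1)%g; rewrite ?phi_word.
Qed.
End DihedralNormalForm.

(** * Branches of the n-th root *)

Section RootBranches.
Variables (K : numFieldType) (n : nat).
Hypothesis n_gt0 : (0 < n)%N.

Lemma cvgX (T : Type) (F : set_system T) (FF : Filter F) (f : T -> K) (a : K) k :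
  f @ F --> a -> f x ^+ k @[x --> F] --> a ^+ k.
Proof.
move=> fa; elim: k => [|k IH]; first exact: cvg_cst.
by under eq_cvg do rewrite exprS; rewrite exprS; exact: cvgM.
Qed.

Lemma is_derive_root_branch (U : set K) (r : K -> K) (t : K) :
  open U -> t != 0 -> root_branch n U r -> U t ->
  is_derive t 1 r (r t / (n%:R * t)).
Proof.
move=> oU t0 rU Ut; have [rc rn] := rU t Ut.
have n0 : n%:R != 0 :> K by rewrite pnatr_eq0 -lt0n.
have rt0 : r t != 0.
  by apply: contra_neq t0 => rt0; rewrite -rn rt0 expr0n gtn_eqF.
(* The cofactor in [z^n - r(t)^n = (z - r(t)) S(z)]; the difference quotient will be [1 / S]. *)
pose S (z : K) := \sum_(i < n) z ^+ (n.-1 - i) * r t ^+ i.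
have h_cvg : (h *: 1 + t) @[h --> (0 : K)^'] --> t.
  under eq_cvg do rewrite [_ *: _]mulr1.
  suff : h + t @[h --> (0 : K)^'] --> 0 + t by rewrite add0r.
  by apply: cvgD; [exact: nbhs_dnbhs | exact: cvg_cst].
have S_cvg : S (r (h *: 1 + t)) @[h --> (0 : K)^'] --> n%:R * r t ^+ n.-1.
  have -> : n%:R * r t ^+ n.-1 = \sum_(i < n) r t ^+ (n.-1 - i) * r t ^+ i.
    rewrite (eq_bigr (fun=> r t ^+ n.-1)) => [|i _].
      by rewrite sumr_const card_ord mulr_natl.
    by rewrite -exprD subnK // -ltnS prednK.
  apply: cvg_big => [|i _]; first exact: add_continuous.
  apply: cvgMl; apply: cvgX; exact: cvg_comp h_cvg rc.
have S0 : n%:R * r t ^+ n.-1 != 0 by rewrite mulf_neq0 ?expf_neq0.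
have quot : h^-1 *: (r (h *: 1 + t) - r t) @[h --> (0 : K)^'] -->
    r t / (n%:R * t).
  have -> : r t / (n%:R * t) = (n%:R * r t ^+ n.-1)^-1.
    have tE : t = r t ^+ n.-1 * r t by rewrite -exprSr prednK.
    rewrite [X in _ / (_ * X)]tE.
    by field; rewrite n0 rt0 expf_neq0.
  apply: cvg_trans (cvgV S0 S_cvg); apply: near_eq_cvg.
  near=> h.
  (* Openness of [U] keeps the nearby point in the domain, where the [n]-th power of [r] is
     known. *)
  have hU : U (h *: 1 + t) by near: h; apply: h_cvg; exact: open_nbhs_nbhs.
  have h0 : h != 0 by near: h; exact: nbhs_dnbhs_neq.
  have [_ rnh] := rU _ hU.
  have: h = (r (h *: 1 + t) - r t) * S (r (h *: 1 + t)).
    by rewrite -subrXX rnh rn addrK [_ *: _]mulr1.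
  rewrite /=; move: (r (h *: 1 + t) - r t) (S (r (h *: 1 + t))) => d s hE.
  have := h0; rewrite hE mulf_eq0 negb_or => /andP[d0 s0].
  by rewrite [RHS]mulrC invfM mulrA mulfV // mul1r.
by apply: DeriveDef; [apply: cvgP quot | exact: cvg_lim quot].
Unshelve. all: by end_near.
Qed.
End RootBranches.

(** * The principal branch of the [n]-th root on the slit plane *)

Section ComplexRoot.
Variable R : realType.
Local Notation C := (R[i] : numFieldType).
Local Notation Re := (@complex.Re R).
Local Notation Im := (@complex.Im R).

Lemma normc_real (x : R) : `|x%:C%C| = `|x|%:C%C :> R[i].
Proof. by rewrite normc_def /= expr0n addr0 sqrtr_sqr. Qed.

(** A positive [e] in [R[i]] is real, so the real estimate for its real part suffices. *)
Lemma cvg_real_complex (T : Type) (F : set_system T) (FF : Filter F) (f : T -> R) (a : R) :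
  f @ F --> a -> ((f x)%:C%C : C) @[x --> F] --> (a%:C%C : C).
Proof.
move=> /cvgrPdist_lt fa; apply/cvgrPdist_lt => e; rewrite ltcE => /andP[/eqP e_im e_re].
apply: filterS (fa _ e_re) => x; rewrite -rmorphB normc_real ltcE /= => ->.
by rewrite andbT e_im.
Qed.

Lemma cvg_complex (T : Type) (F : set_system T) (FF : Filter F) (f g : T -> R) (a b : R) :
  f @ F --> a -> g @ F --> b -> ((f x +i* g x)%C : C) @[x --> F] --> ((a +i* b)%C : C).
Proof.
move=> fa gb.
have cE x y : (x +i* y)%C = x%:C%C + 'i%C * y%:C%C :> C by exact: complexE.
rewrite cE (_ : (fun _ => _) = fun x => (f x)%:C%C + 'i%C * (g x)%:C%C :> C); last first.
  by apply: funext => x; rewrite cE.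
apply: cvgD; first exact: cvg_real_complex.
by apply: cvgM; [exact: cvg_cst | exact: cvg_real_complex].
Qed.

Lemma Re_continuous : continuous (Re : C -> R).
Proof.
move=> z; apply/(@cvgrPdist_lt _ _ _ _ (nbhs_filter z)) => e e0.
have eC0 : 0 < (e%:C%C : C) by rewrite ltcR.
have := @cvgr_dist_lt C C C _ (nbhs_filter z) id z (fun A => id) _ eC0.
apply: filterS => w.
rewrite normc_def ltcR; apply: le_lt_trans.
rewrite -sqrtr_sqr (_ : Re z - Re w = Re (z - w)); last by case: z w => [? ?] [? ?].
by apply: ler_wsqrtr; rewrite lerDl sqr_ge0.
Qed.

Lemma Im_continuous : continuous (Im : C -> R).
Proof.
move=> z; apply/(@cvgrPdist_lt _ _ _ _ (nbhs_filter z)) => e e0.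
have eC0 : 0 < (e%:C%C : C) by rewrite ltcR.
have := @cvgr_dist_lt C C C _ (nbhs_filter z) id z (fun A => id) _ eC0.
apply: filterS => w.
rewrite normc_def ltcR; apply: le_lt_trans.
rewrite -sqrtr_sqr (_ : Im z - Im w = Im (z - w)); last by case: z w => [? ?] [? ?].
by apply: ler_wsqrtr; rewrite lerDr sqr_ge0.
Qed.

(** The absolute value as an element of [R], since the norm on [R[i]] takes values in [R[i]]. *)
Definition modulus (z : C) : R := Num.sqrt (Re z ^+ 2 + Im z ^+ 2).

(* Half-angle formula: [Arg z = 2 * atan (Im z / (Re z + |z|))] off the
   closed negative real axis. *)
Definition argument (z : C) : R := 2 * atan (Im z / (Re z + modulus z)).

Definition principal_root (n : nat) (z : C) : C :=
  let m := expR (ln (modulus z) / n%:R) in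
  let a := argument z / n%:R in
  ((m * cos a)%R +i* (m * sin a)%R)%C.

Lemma sqr_modulus z : modulus z ^+ 2 = Re z ^+ 2 + Im z ^+ 2.
Proof. by rewrite sqr_sqrtr // addr_ge0 ?sqr_ge0. Qed.

(** If [Re z <= 0] then [Im z != 0] off the slit, which makes the modulus strictly larger than
    [- Re z]. This keeps the denominator in [argument] away from zero. *)
Lemma slit_plane_gt0 z : @slit_plane C z -> 0 < Re z + modulus z.
Proof.
move=> /negP; rewrite lecE /= negb_and => hz.
have m0 : 0 <= modulus z by exact: sqrtr_ge0.
have := sqr_modulus z; move: hz m0; case: (ltP 0 (Re z)) => [x0 _ m0 _|x0].
  exact: ltr_wpDr.
rewrite orbF eq_sym => y0 m0 hm.
have y2 : 0 < Im z ^+ 2 by rewrite exprn_even_gt0.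
by nra.
Qed.

Lemma modulus_gt0 z : @slit_plane C z -> 0 < modulus z.
Proof.
move=> /[dup] /slit_plane_gt0 s0 /negP; rewrite lecE /= negb_and => hz.
rewrite sqrtr_gt0; have := sqr_ge0 (Re z); have := sqr_ge0 (Im z).
case/orP: hz => [|/= hz].
  by rewrite eq_sym => y0; have : 0 < Im z ^+ 2; [rewrite exprn_even_gt0 | lra].
by have : 0 < Re z ^+ 2; [rewrite exprn_gt0 // ltNge | lra].
Qed.

(** With [u = y / (x + m)] the tangent of the half angle, the double-angle formulas give cosine
    [(1 - u^2) / (1 + u^2)] and sine [2u / (1 + u^2)], which [m^2 = x^2 + y^2] turns into [x / m]
    and [y / m]. *)
Lemma polar_form z : @slit_plane C z ->
  z = ((modulus z * cos (argument z))%R +i* (modulus z * sin (argument z))%R)%C.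
Proof.
move=> hz; have s0 := slit_plane_gt0 _ hz; have m0 := modulus_gt0 _ hz.
have hm := sqr_modulus z; rewrite /argument.
set u := Im z / _; set c := cos (atan u).
have c0 : c != 0 by rewrite gt_eqF // cos_gt0_pihalf // atan_gtNpi2 atan_ltpi2.
have sE : sin (atan u) = u * c by rewrite -[u in RHS]atanK /tan divfK.
have c2 : c ^+ 2 = (1 + u ^+ 2)^-1.
  by rewrite /c cos_atan exprVn sqr_sqrtr // addr_ge0 ?sqr_ge0.
rewrite mulr_natl mulr2n cosD sinD -/c sE.
have -> : c * c - u * c * (u * c) = (1 - u ^+ 2) * c ^+ 2 by ring.
have -> : u * c * c + c * (u * c) = 2 * u * c ^+ 2 by ring.
rewrite c2 {c sE c0 c2}/u {u}; case: z hm s0 m0 {hz} => x y.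
move: (modulus _) => m /= hm s0 m0.
have sm : (x + m) ^+ 2 + y ^+ 2 = 2 * m * (x + m) by ring: hm.
have d0 : (x + m) ^+ 2 + y ^+ 2 != 0 by rewrite sm gt_eqF // !mulr_gt0.
have s0' : x + m != 0 by rewrite gt_eqF.
have m0' : m != 0 by rewrite gt_eqF.
have -> : (1 + (y / (x + m)) ^+ 2)^-1 = (x + m) / (2 * m).
  have -> : 1 + (y / (x + m)) ^+ 2 = ((x + m) ^+ 2 + y ^+ 2) / (x + m) ^+ 2.
    by field.
  by rewrite sm; field; rewrite m0'.
congr complex.Complex; last by field; rewrite s0' m0'.
have -> : 1 - (y / (x + m)) ^+ 2 = 2 * x / (x + m).
  have y2 : y ^+ 2 = m ^+ 2 - x ^+ 2 by rewrite hm addrAC subrr add0r.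
  by rewrite expr_div_n y2; field.
by field; rewrite s0' m0'.
Qed.

Lemma de_moivre (m a : R) n :
  ((m * cos a)%R +i* (m * sin a)%R)%C ^+ n = ((m ^+ n * cos (a *+ n))%R +i* (m ^+ n * sin (a *+ n))%R)%C :> C.
Proof.
elim: n => [|n IH]; first by rewrite !mulr0n cos0 sin0 !expr0 mulr0 mulr1.
rewrite exprS IH mulrS cosD sinD exprS.
by apply/eqP; rewrite eq_complex /=; apply/andP; split; apply/eqP; ring.
Qed.

Lemma root_branch_principal_root n : (0 < n)%N ->
  root_branch n (@slit_plane C) (principal_root n).
Proof.
move=> n_gt0 z hz; have s0 := slit_plane_gt0 _ hz; have m0 := modulus_gt0 _ hz.
have n0 : n%:R != 0 :> R by rewrite pnatr_eq0 -lt0n.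
split.
  have zF : Filter (nbhs (z : C)) := nbhs_filter z.
  have sqr_cvg : Re w ^+ 2 + Im w ^+ 2 @[w --> z] --> Re z ^+ 2 + Im z ^+ 2.
    by apply: cvgD; apply: (cvgX _ _ _ zF); [exact: Re_continuous | exact: Im_continuous].
  have modulus_cvg : modulus w @[w --> z] --> modulus z.
    exact: cvg_comp sqr_cvg (@sqrt_continuous R _).
  have quot_cvg : Im w / (Re w + modulus w) @[w --> z] -->
      Im z / (Re z + modulus z).
    apply: cvgM; first exact: Im_continuous.
    apply: cvgV; first by rewrite gt_eqF.
    by apply: cvgD => //; exact: Re_continuous.
  have arg_cvg : argument w / n%:R @[w --> z] --> argument z / n%:R.
    apply: cvgM; last exact: cvg_cst.
    apply: cvgM; first exact: cvg_cst.
    exact: cvg_comp quot_cvg (@continuous_atan R _).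
  have ln_cvg : ln (modulus w) / n%:R @[w --> z] --> ln (modulus z) / n%:R.
    apply: cvgM; last exact: cvg_cst.
    exact: cvg_comp modulus_cvg (@continuous_ln R _ m0).
  have exp_cvg : expR (ln (modulus w) / n%:R) @[w --> z] -->
      expR (ln (modulus z) / n%:R).
    exact: cvg_comp ln_cvg (@continuous_expR R _).
  apply: cvg_complex; apply: cvgM => //.
  - exact: cvg_comp arg_cvg (@continuous_cos R _).
  - exact: cvg_comp arg_cvg (@continuous_sin R _).
(* The [n]-th power undoes both divisions by [n], leaving the polar form of [z]. *)
rewrite /principal_root de_moivre -expRM_natr -[(_ / _) *+ n]mulr_natr !divfK // lnK //.
by rewrite -polar_form.
Qed.
End ComplexRoot.

(** * Algebraicity and the solution attached to a root branch *)

Lemma algebraic_on_root_branch (K : numFieldType) (n : nat) (U : set K) (r : K -> K) :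
  (0 < n)%N -> root_branch n U r -> algebraic_on U r.
Proof.
(* The polynomial is [y^n - t]: the outer ['X] is [y], the inner one is [t]. *)
move=> n_gt0 rU; exists ('X^n - ('X)%:P); first by rewrite monic_neq0 ?monicXnsubC.
by move=> t /rU[_ rn]; rewrite !(hornerE, horner_exp) rn subrr.
Qed.

Lemma algebraic_on_cst (K : numFieldType) (U : set K) (c : K) :
  algebraic_on U (fun=> c).
Proof.
exists ('X - c%:P%:P); first by rewrite polyXsubC_eq0.
by move=> t _; rewrite !hornerE subrr.
Qed.

(** The centred unknowns all vanish here and the [f_j] coincide, so what remains is
    [t r' / r = 1 / n], given by the derivative of the branch. *)
Lemma root_branch_solves (K : numFieldType) (n : nat) (U : set K) (r : K -> K) :
  (0 < n)%N -> admissible U -> root_branch n U r ->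
  solves U (fun t => (const_mx (r t), \row_(j < n) centre K n j)).
Proof.
move=> n_gt0 [oU U0] rU f d t Ut; have [_ rn] := rU t Ut.
have t0 : t != 0 by apply: contra_notN U0 => /eqP <-.
have n0 : n%:R != 0 :> K by rewrite pnatr_eq0 -lt0n.
have rt0 : r t != 0.
  by apply: contra_neq t0 => rt0; rewrite -rn rt0 expr0n gtn_eqF.
have fE j : f j = r by apply: funext => s; rewrite /f mxE.
have dE j : d j = cst (centre K n j) by apply: funext => s; rewrite /d mxE.
have [r_der r_val] := is_derive_root_branch K n n_gt0 U r t oU t0 rU Ut.
split=> [j||| j |j].
- by rewrite fE dE; split=> //; exact: derivable_cst.
- by under eq_bigr do rewrite dE; exact: sum_centre.
- by under eq_bigr do rewrite fE; rewrite prodr_const card_ord.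
- rewrite fE !dE /cst centre_diff // derive1E r_val subrK.
  by field; rewrite n0 t0 rt0.
- by rewrite dE !fE subrr derive1E derive_cst mulr0.
Qed.

Theorem mainTheorem2 (R : realType) (n : nat) (hn : (3 <= n)%N) :
  [/\ preserves_S (@rho R[i] n),
      exists (pi : {perm 'I_n}) (c : 'I_n -> R[i]),
        [/\ (pi ^+ 2 = 1)%g,
            forall j, c j = 1 / n%:R \/ c j = - ((n%:R - 1) / n%:R),
            \sum_j c j = 0,
            preserves_S (@sigma R[i] n pi c)
          & dihedral_of_order (2 * n)
              (generated_by [set @rho R[i] n; @sigma R[i] n pi c])],
      exists r : R[i] -> R[i], root_branch n (@slit_plane R[i]) r
    & forall (U : set R[i]) (r : R[i] -> R[i]),
        admissible U -> root_branch n U r ->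
        exists d : R[i] -> 'rV[R[i]]_n,
          [/\ solves U (fun t => (const_mx (r t), d t)),
              algebraic_on U r
            & forall j, algebraic_on U (fun t => d t 0 j)]].

Proof.
have n_gt0 : (0 < n)%N by lia.
have n_gt1 : (1 < n)%N by lia.
split; first exact: preserves_S_rho.
- exists (reflection_perm n), (reflection_shift R[i] n); split.
  + by apply/permP => j; rewrite expgS expg1 permM reflection_permK perm1.
  + move=> j; rewrite reflection_shiftE //; case: eqP => _; [right|left].
      by rewrite mulr1n; field; rewrite pnatr_eq0 -lt0n.
    by rewrite subr0.
  + exact: sum_reflection_shift.
  + exact: preserves_S_sigma.
  + apply: dihedral_generated => //.
    * exact: iter_rho_n.
    * exact: sigmaK.
    * exact: sigma_rhoK.
    * exact: iter_rho_id.
    * by move=> i; exact: iter_rho_sigma.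
- by exists (principal_root R n); exact: root_branch_principal_root.
- move=> U r adU rU; exists (fun=> \row_j centre R[i] n j); split.
  + exact: root_branch_solves.
  + exact: algebraic_on_root_branch rU.
  + by move=> j; under eq_fun do rewrite mxE; exact: algebraic_on_cst.
Qed.
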